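(* Let $X$ and $Y$ be non-trivial real Banach spaces, let $H$ be a closed subspace of $\mathcal{L}(X,Y)$ containing the finite rank operators, and let $\delta>0$. (a) If $X^\ast$ is $\delta$-average rough and $Y$ is alternatively octahedral, then $H$ is $\delta$-average rough. (b) If $X^\ast$ is alternatively octahedral and $Y$ is $\delta$-average rough, then $H$ is $\delta$-average rough.
   Context: For Banach spaces $X,Y$, $\mathcal{L}(X,Y)$ is the Banach space of all bounded linear operators from $X$ to $Y$ with the operator norm, $X^\ast$ is the dual of $X$, and $S_X$ is the unit sphere of $X$. ''$H$ contains the finite rank operators'' means that $H$ contains all bounded finite rank operators from $X$ to $Y$; $H$ carries the operator norm. Let $Z$ be a Banach space and $\delta>0$. $Z$ is $\delta$-average rough if, whenever $n\in\mathbb{N}$ and $z_1,\dots,z_n\in S_Z$, \[\limsup_{\|y\|\to 0}\frac1n\sum_{i=1}^n\frac{\|z_i+y\|+\|z_i-y\|-2}{\|y\|}\geq\delta\] (the limsup is over $y\in Z\setminus\{0\}$). $Z$ is alternatively octahedral if, whenever $n\in\mathbb{N}$, $z_1,\dots,z_n\in S_Z$, and $\varepsilon>0$, there is a $y\in S_Z$ such that $\max\{\|z_i+y\|,\|z_i-y\|\}\geq 2-\varepsilon$ for all $i\in\{1,\dots,n\}$. *)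

(* Defs.v *)
From HB Require Import structures.
From mathcomp Require Import all_boot all_order all_algebra.
From mathcomp Require Import all_classical all_reals all_analysis.

Set Implicit Arguments.
Unset Strict Implicit.
Unset Printing Implicit Defensive.

Import Order.TTheory GRing.Theory Num.Theory.
Import numFieldNormedType.Exports.

Local Open Scope classical_set_scope.
Local Open Scope ring_scope.

Section bounded_operators.
Context {R : realType} (X Y : normedModType R).

Definition bounded_linear : {pred X -> Y} := fun f =>
  `[< linear f /\ exists M : R, forall x, `|f x| <= M * `|x| >].

Lemma bounded_linear_submod_closed : submod_closed bounded_linear.
Proof.
split=> [|a f g /asboolP[lf [M fM]] /asboolP[lg [N gN]]]; apply/asboolP; split.
- by move=> a x y; rewrite scaler0 addr0.
- by exists 0 => x; rewrite normr0 mul0r.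
- move=> b x y; rewrite !fctE lf lg !scalerDr !scalerA (mulrC a b).
  by rewrite -!addrA; congr (_ + _); rewrite addrCA.
- exists (`|a| * M + N) => x; rewrite !fctE (le_trans (ler_normD _ _))//.
  by rewrite normrZ mulrDl -mulrA lerD// ler_wpM2l.
Qed.

HB.instance Definition _ := GRing.isSubmodClosed.Build R (X -> Y)
  bounded_linear bounded_linear_submod_closed.

Record boundedOp : predArgType :=
  BoundedOp { boundedOp_fun :> X -> Y ; _ : boundedOp_fun \in bounded_linear }.

HB.instance Definition _ := [isSub for boundedOp_fun].
HB.instance Definition _ := [Choice of boundedOp by <:].
HB.instance Definition _ := [SubChoice_isSubLmodule of boundedOp by <:].

Implicit Types T S : boundedOp.

Lemma boundedOp_linear T : linear T.
Proof. by have /asboolP[] := valP T. Qed.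

HB.instance Definition _ T :=
  GRing.isLinear.Build R X Y *:%R (boundedOp_fun T) (@boundedOp_linear T).

Lemma boundedOp_bounded T : exists M : R, forall x, `|T x| <= M * `|x|.
Proof. by have /asboolP[] := valP T. Qed.

Definition opnorm T : R := sup [set `|T x| | x in [set x : X | `|x| <= 1]].

Lemma opnorm_has_sup T : has_sup [set `|T x| | x in [set x : X | `|x| <= 1]].
Proof.
split; first by exists `|T 0|, 0 => //=; rewrite normr0.
have [M TM] := boundedOp_bounded T; exists `|M| => _ [x /= x1 <-].
rewrite (le_trans (TM x))// (@le_trans _ _ (`|M| * `|x|)) ?ler_wpM2r ?ler_norm//.
by rewrite ler_piMr.
Qed.

Lemma le_opnorm1 T x : `|x| <= 1 -> `|T x| <= opnorm T.
Proof. by move=> x1; apply: (sup_upper_bound (opnorm_has_sup T)); exists x. Qed.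

Lemma opnorm_le T M : (forall x, `|x| <= 1 -> `|T x| <= M) -> opnorm T <= M.
Proof.
move=> TM; apply: ge_sup; first exact: (opnorm_has_sup T).1.
by move=> _ [x /= x1 <-]; exact: TM.
Qed.

Lemma opnorm_ge0 T : 0 <= opnorm T.
Proof. by rewrite (le_trans _ (@le_opnorm1 T 0 _)) ?normr0. Qed.

Lemma le_opnorm T x : `|T x| <= opnorm T * `|x|.
Proof.
have [->|x0] := eqVneq x 0; first by rewrite linear0 !normr0 mulr0.
rewrite -ler_pdivrMr ?normr_gt0//.
have := @le_opnorm1 T (`|x|^-1 *: x); rewrite linearZ !normrZ normfV normr_id.
by rewrite mulVf ?normr_eq0// mulrC; exact.
Qed.

Lemma opnormD T S : opnorm (T + S) <= opnorm T + opnorm S.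
Proof.
apply: opnorm_le => x x1; rewrite (le_trans (ler_normD _ _))//.
by rewrite lerD// le_opnorm1.
Qed.

Let opnormZ_le (a : R) T : opnorm (a *: T) <= `|a| * opnorm T.
Proof.
by apply: opnorm_le => x x1; rewrite [leLHS]normrZ ler_wpM2l// le_opnorm1.
Qed.

Lemma opnormZ (a : R) T : opnorm (a *: T) = `|a| * opnorm T.
Proof.
have [->|a0] := eqVneq a 0.
  apply/eqP; rewrite eq_le opnormZ_le/= normr0 mul0r; exact: opnorm_ge0.
apply/eqP; rewrite eq_le opnormZ_le/= -ler_pdivlMl ?normr_gt0//.
by rewrite -normfV (le_trans _ (opnormZ_le _ _))// scalerA mulVf// scale1r.
Qed.

Lemma opnorm_eq0 T : opnorm T = 0 -> T = 0.
Proof.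
move=> T0; apply/val_inj/funext => x; apply/eqP.
by rewrite -normr_le0 (le_trans (le_opnorm T x))// T0 mul0r.
Qed.

HB.instance Definition _ :=
  Lmodule_isNormed.Build R boundedOp opnormD opnormZ opnorm_eq0.

Lemma boundedOp_normE T : `|T| = opnorm T.
Proof. by []. Qed.

Definition finite_rank T := exists (n : nat) (v : 'I_n -> Y),
  range T = [set \sum_(i < n) c i *: v i | c in [set: 'I_n -> R]].

End bounded_operators.

Definition dual {R : realType} (X : normedModType R) := boundedOp X R^o.
HB.instance Definition _ {R : realType} (X : normedModType R) :=
  NormedModule.on (dual X).

Section subspace_norm.
Context {R : realType} {V : normedModType R} (H : submodClosed V).

Record subspaceOf : predArgType :=
  SubspaceOf { subspaceOf_val :> V ; _ : subspaceOf_val \in H }.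

HB.instance Definition _ := [isSub for subspaceOf_val].
HB.instance Definition _ := [Choice of subspaceOf by <:].
HB.instance Definition _ := [SubChoice_isSubLmodule of subspaceOf by <:].

Definition subspace_norm (u : subspaceOf) : R := `|subspaceOf_val u|.

Lemma subspace_normD u v :
  subspace_norm (u + v) <= subspace_norm u + subspace_norm v.
Proof. exact: ler_normD. Qed.

Lemma subspace_normZ (a : R) u : subspace_norm (a *: u) = `|a| * subspace_norm u.
Proof. exact: normrZ. Qed.

Lemma subspace_norm_eq0 u : subspace_norm u = 0 -> u = 0.
Proof. by move/normr0_eq0 => u0; exact: val_inj. Qed.

HB.instance Definition _ := Lmodule_isNormed.Build R subspaceOf
  subspace_normD subspace_normZ subspace_norm_eq0.

Lemma subspace_normE (u : subspaceOf) : `|u| = `|subspaceOf_val u|.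
Proof. by []. Qed.

End subspace_norm.

Section roughness.
Context {R : realType} (Z : normedModType R).

(* The case [n = 0] is excluded: the empty average is 0, so the bound would be
   false. *)
Definition average_quotient (n : nat) (z : 'I_n -> Z) (y : Z) : R :=
  n%:R^-1 * \sum_(i < n) (`|z i + y| + `|z i - y| - 2) / `|y|.

Definition average_rough (delta : R) := forall (n : nat) (z : 'I_n -> Z),
  (0 < n)%N -> (forall i, `|z i| = 1) ->
  (delta%:E <= limf_esup (EFin \o average_quotient z) ((0 : Z)^')%R)%E.

Definition alternatively_octahedral := forall (n : nat) (z : 'I_n -> Z) (e : R),
  (0 < n)%N -> (forall i, `|z i| = 1) -> 0 < e ->
  exists2 y : Z, `|y| = 1 &
    forall i, 2 - e <= Num.max `|z i + y| `|z i - y|.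

End roughness.

(* Main.v *)
(* By convexity, the quotient (|z + s y| + |z - s y| - 2) / s is nondecreasing
   in s > 0, so delta-average roughness already holds with perturbations y of any
   prescribed norm t.  Having fixed t, one may make errors of size small
   compared to t.  Norm the operators T_i approximately by points x_i and
   functionals g_i.  In (a), octahedrality of Y gives a unit vector y that all
   g_i (suitably chosen) nearly norm up to sign; then the rank-one
   perturbations T_i + x* (.) y are bounded below by g_i T_i +- x*, and
   roughness of X* yields x*.  Part (b) is dual: octahedrality of X* gives x*,
   the x_i nearly norm it up to sign, and roughness of Y, applied to the
   T_i x_i, yields y.  The norming functionals come from Hahn-Banach. *)
Require Import Defs.
From mathcomp Require Import all_boot all_order all_algebra.
From mathcomp Require Import all_classical all_reals all_analysis.
From mathcomp Require Import ring lra.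
Import Order.TTheory GRing.Theory Num.Theory.
Import numFieldNormedType.Exports.
Local Open Scope classical_set_scope.
Local Open Scope ring_scope.

(** * Hahn-Banach through minimal sublinear functionals *)

Section sublinear.
Context {R : realType} {V : lmodType R}.
Implicit Types (p q : V -> R) (x y : V) (a : R).

Definition sublinear p :=
  (forall x y, p (x + y) <= p x + p y) /\
  (forall a x, 0 <= a -> p (a *: x) <= a * p x).

Lemma sublinear0 p : sublinear p -> p 0 = 0.
Proof.
move=> [_ pZ]; apply/eqP; rewrite eq_le.
have := pZ 0 0 (lexx _); rewrite scale0r mul0r => -> /=.
have := pZ 2 0 ltac:(lra); rewrite scaler0; lra.
Qed.

Lemma sublinearN p x : sublinear p -> - p (- x) <= p x.
Proof.
move=> sp; have := sp.1 x (- x); rewrite subrr (sublinear0 _ sp); lra.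
Qed.

Lemma le_mul_inf (S : set R) (a m : R) : S !=set0 -> 0 <= a ->
  (forall s, S s -> m <= a * s) -> m <= a * inf S.
Proof.
move=> [s0 Ss0]; rewrite le_eqVlt => /orP[/eqP<- /(_ _ Ss0)|a0 mS].
  by rewrite !mul0r.
rewrite -ler_pdivrMl//; apply: lb_le_inf; first by exists s0.
by move=> s /mS; rewrite -ler_pdivrMl.
Qed.

(** Two members of a chain are comparable, so the smaller one can bound both terms of a sum; this
    keeps the infimum subadditive. *)
Lemma sublinear_inf (P : set (V -> R)) q :
  P !=set0 -> (forall p, P p -> sublinear p) ->
  (forall p, P p -> forall x, p x <= q x) ->
  total_on P (fun p p' => forall x, p' x <= p x) ->
  let m x := inf [set p x | p in P] in
  sublinear m /\ forall p, P p -> forall x, m x <= p x.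
Proof.
move=> [p0 Pp0] Psub Pq Ptot m.
have m_le p x : P p -> m x <= p x.
  move=> Pp; apply: ge_inf; last by exists p.
  (* [p' x >= - p' (- x) >= - q (- x)], so the values at [x] are bounded below. *)
  exists (- q (- x)) => _ [p' Pp' <-].
  by rewrite (le_trans _ (sublinearN _ x (Psub _ Pp')))// lerN2 Pq.
have P0 x : [set p x | p in P] !=set0 by exists (p0 x), p0.
split; last by move=> p Pp x; exact: m_le.
split=> [x y|a x a0].
- rewrite -lerBlDr; apply: lb_le_inf => // _ [p Pp <-].
  rewrite lerBlDr -lerBlDl; apply: lb_le_inf => // _ [p' Pp' <-].
  rewrite lerBlDl.
  case: (Ptot _ _ Pp Pp') => le_pp.
    rewrite (le_trans (m_le _ _ Pp'))// (le_trans ((Psub _ Pp').1 _ _))//.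
    by rewrite lerD2r.
  rewrite (le_trans (m_le _ _ Pp))// (le_trans ((Psub _ Pp).1 _ _))//.
  by rewrite lerD2l.
- apply: le_mul_inf => // _ [p Pp <-].
  by rewrite (le_trans (m_le _ _ Pp))// (Psub _ Pp).2.
Qed.

(** For sublinear [p], this is the largest sublinear functional below [p] whose value at [- y] is at
    most [- p y]. *)
Definition descend p y x : R :=
  inf [set p (x + t *: y) - t * p y | t in [set t | 0 <= t]].

Lemma sublinearZ p x a : sublinear p -> 0 <= a -> p (a *: x) = a * p x.
Proof.
move=> sp; rewrite le_eqVlt => /orP[/eqP<-|a0].
  by rewrite scale0r mul0r sublinear0.
apply/eqP; rewrite eq_le (sp.2 _ _ (ltW a0))/= -ler_pdivlMl//.
have := sp.2 a^-1 (a *: x) ltac:(by rewrite invr_ge0 ltW).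
by rewrite scalerA mulVf ?gt_eqF// scale1r.
Qed.

Lemma descend_le p y x t : sublinear p -> 0 <= t ->
  descend p y x <= p (x + t *: y) - t * p y.
Proof.
move=> sp t0; apply: ge_inf; last by exists t.
exists (- p (- x)) => _ [s s0 <-].
have := sp.1 (x + s *: y) (- x); rewrite addrAC subrr add0r.
by rewrite (sublinearZ _ _ _ sp s0); lra.
Qed.

Lemma sublinear_descend p y : sublinear p -> sublinear (descend p y).
Proof.
move=> sp.
have D0 x : [set p (x + t *: y) - t * p y | t in [set t | 0 <= t]] !=set0.
  by exists (p (x + 0 *: y) - 0 * p y), 0 => /=.
split=> [x x'|a x a0].
- rewrite -lerBlDr; apply: lb_le_inf => // _ [t t0 <-].
  rewrite lerBlDr -lerBlDl; apply: lb_le_inf => // _ [s s0 <-].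
  rewrite lerBlDl (le_trans (descend_le _ _ _ (t + s) sp _)) ?addr_ge0//.
  have := sp.1 (x + t *: y) (x' + s *: y); rewrite addrACA -scalerDl; lra.
- apply: le_mul_inf => // _ [t t0 <-].
  rewrite (le_trans (descend_le _ _ _ (a * t) sp _)) ?mulr_ge0//.
  have := sp.2 a (x + t *: y) a0; rewrite scalerDr scalerA; lra.
Qed.

Lemma descend_le_id p y x : sublinear p -> descend p y x <= p x.
Proof.
move=> sp; have := descend_le _ y x 0 sp (lexx _).
by rewrite scale0r addr0 mul0r subr0.
Qed.

(** Zorn's lemma for the reversed pointwise order below [q]: a nonempty chain is bounded by its
    pointwise infimum, the empty one by [q]. *)
Lemma minimal_sublinear q : sublinear q -> exists p, [/\ sublinear p,
  forall x, p x <= q x & forall p', sublinear p' -> (forall x, p' x <= p x) ->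
    forall x, p x <= p' x].
Proof.
move=> sq.
pose S := {p | sublinear p /\ forall x, p x <= q x}.
pose ge (p p' : S) := `[< forall x, sval p' x <= sval p x >].
have q_in_S : sublinear q /\ forall x, q x <= q x by [].
have := @ZL_preorder S (exist _ q q_in_S) ge.
case=> [p|p1 p2 p3 /asboolP h12 /asboolP h23|A Atot|].
- by apply/asboolP.
- by apply/asboolP => x; exact: le_trans (h23 x) (h12 x).
- have [->|/set0P A0] := eqVneq A set0; first by exists (exist _ q q_in_S).
  have [||||sm m_le] := @sublinear_inf [set sval p | p in A] q.
  + by case: A0 => p Ap; exists (sval p), p.
  + by move=> _ [p Ap <-]; exact: (svalP p).1.
  + by move=> _ [p Ap <-]; exact: (svalP p).2.
  + move=> _ _ [p Ap <-] [p' Ap' <-].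
    by case: (Atot _ _ Ap Ap') => /asboolP ?; [left|right].
  + set m := (fun x => _) in sm m_le.
    have m_in_S : sublinear m /\ forall x, m x <= q x.
      split=> // x; case: A0 => p Ap.
      by apply: le_trans ((svalP p).2 x); apply: m_le; exists p.
    exists (exist _ m m_in_S) => p Ap; apply/asboolP => x /=.
    by apply: m_le; exists p.
- move=> [p [sp pq]] pmin; exists p; split=> // p' sp' p'p.
  have p'S : sublinear p' /\ forall x, p' x <= q x.
    by split=> // x; exact: le_trans (p'p x) (pq x).
  by have /asboolP := pmin (exist _ p' p'S) ltac:(exact/asboolP).
Qed.

(* A minimal sublinear functional agrees with each of its descents, and the
   descent along [y] forces [p (x + y) = p x + p y]. *)
Lemma linear_minorant q : sublinear q ->
  exists2 f : V -> R, linear f & forall x, f x <= q x.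
Proof.
move=> /minimal_sublinear[p [sp pq pmin]]; exists p => //.
have pD x y : p (x + y) = p x + p y.
  apply/eqP; rewrite eq_le sp.1/= -lerBrDr.
  apply: le_trans (pmin _ (sublinear_descend _ y sp) _ x) _.
    by move=> z; exact: descend_le_id.
  by have := descend_le _ y x 1 sp ler01; rewrite scale1r mul1r.
have pN x : p (- x) = - p x.
  by apply/eqP; rewrite -addr_eq0 -pD addrC subrr sublinear0.
move=> a x y; rewrite pD; congr (_ + _).
have [a0|/ltW a0] := leP 0 a; first exact: sublinearZ.
rewrite -[a]opprK scaleNr pN sublinearZ ?oppr_ge0//.
by rewrite scaleNr.
Qed.

End sublinear.

(** * Norming functionals *)

Section norming_functional.
Context {R : realType} (V : normedModType R).

Lemma sublinear_norm : sublinear (fun x : V => `|x|).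
Proof.
by split=> [x y|a x a0]; [exact: ler_normD|rewrite normrZ ger0_norm].
Qed.

Lemma boundedOp_contraction (f : V -> R^o) : linear f ->
  (forall x, `|f x| <= `|x|) -> exists2 g : dual V, `|g| <= 1 & g =1 f.
Proof.
move=> lf fx.
have fb : f \in @bounded_linear R V R^o.
  by apply/asboolP; split=> //; exists 1 => x; rewrite mul1r.
by exists (BoundedOp fb) => //; apply: opnorm_le => x; apply: le_trans.
Qed.

(* Descending the norm along [z] once makes every linear minorant [f] satisfy
   [f (- z) <= - `|z|]. *)
Lemma norming_functional (z : V) :
  exists g : dual V, `|g| <= 1 /\ g z = `|z|.
Proof.
have sn := sublinear_norm.
have [f lf f_le] := linear_minorant _ (sublinear_descend _ z sn).
have f_norm x : f x <= `|x| by rewrite (le_trans (f_le x)) ?descend_le_id.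
have fN x : f (- x) = - f x.
  have f0 : f 0 = 0.
    have := lf 1 0 0; rewrite scaler0 addr0 scale1r; lra.
  by have := lf (- 1) x 0; rewrite scaleN1r addr0 f0 addr0 => ->; rewrite scaleN1r.
have [|g g1 gf] := boundedOp_contraction f lf.
  by move=> x; rewrite ler_norml f_norm andbT lerNl -fN -normrN f_norm.
exists g; split=> //; apply/eqP; rewrite gf eq_le f_norm/=.
have := le_trans (f_le (- z)) (descend_le _ z (- z) 1 sn ler01).
rewrite fN scale1r addNr normr0; lra.
Qed.

End norming_functional.

(** * Average roughness at a prescribed scale *)

Section roughness_at_scale.
Context {R : realType}.

(** [s *: (z + w)] differs from [z + s *: w] by [(s - 1) *: z], of norm [s - 1]; the triangle
    inequality is used for [w = y] and [w = - y]. *)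
Lemma symmetric_increment_scale (Z : normedModType R) (z y : Z) (s : R) :
  1 <= s -> `|z| = 1 ->
  s * (`|z + y| + `|z - y| - 2) <= `|z + s *: y| + `|z - s *: y| - 2.
Proof.
move=> s1 z1.
have s0 : 0 <= s by lra.
have h w : s * `|z + w| <= `|z + s *: w| + (s - 1).
  rewrite -{1}(ger0_norm s0) -normrZ scalerDr.
  have -> : s *: z + s *: w = (z + s *: w) + (s - 1) *: z.
    by rewrite scalerBl scale1r addrAC [z + _]addrC subrK.
  rewrite (le_trans (ler_normD _ _))// normrZ z1 mulr1 ger0_norm//; lra.
have := h y; have := h (- y); rewrite scalerN; lra.
Qed.

(** Forward, the limsup yields a perturbation of norm below [t], which is stretched to norm [t];
    backward, every punctured neighbourhood of 0 contains a small sphere. *)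
Lemma average_rough_at_scale (Z : normedModType R) (delta : R) :
  average_rough Z delta <->
  (forall (n : nat) (z : 'I_n -> Z) (t e : R), (0 < n)%N ->
     (forall i, `|z i| = 1) -> 0 < t -> 0 < e ->
     exists2 y, `|y| = t &
       n%:R * (delta - e) * t <= \sum_(i < n) (`|z i + y| + `|z i - y| - 2)).
Proof.
split=> [rough n z t e n0 z1 t0 e0|rough n z n0 z1].
- pose B : set Z := [set y | `|y| < t /\ y != 0].
  have BF : (0 : Z)^' B.
    rewrite /dnbhs; apply: filterS (nbhsx_ballx (0 : Z) t t0) => y.
    by rewrite -ball_normE /= sub0r normrN.
  have := rough n z n0 z1; rewrite limf_esupE => h.
  have {h} : (delta%:E <= ereal_sup ((EFin \o average_quotient z) @` B))%E.
    apply: le_trans h _; apply: ereal_inf_lbound; by exists B.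
  move=> h.
  have : ((delta - e)%:E < ereal_sup ((EFin \o average_quotient z) @` B))%E.
    by apply: lt_le_trans h; rewrite lte_fin; lra.
  move=> /ereal_sup_gt[_ [y [yt y0] <-]] /=; rewrite lte_fin => hq.
  have ny : 0 < `|y| by rewrite normr_gt0.
  have nR : (0 : R) < n%:R by rewrite ltr0n.
  exists ((t / `|y|) *: y).
    by rewrite normrZ normrM normfV normr_id (gtr0_norm t0) mulfVK ?gt_eqF.
  have s1 : 1 <= t / `|y| by rewrite ler_pdivlMr// mul1r ltW.
  have scaled i := symmetric_increment_scale _ (z i) y _ s1 (z1 i).
  rewrite (le_trans _ (ler_sum _ (fun i _ => scaled i)))//.
  rewrite -mulr_sumr.
  move: hq; rewrite /average_quotient -mulr_suml ltr_pdivlMl// => /ltW hq.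
  by rewrite [leLHS]mulrC -mulrA [_^-1 * _]mulrC ler_pM2l.
- rewrite limf_esupE; apply: le_ereal_inf_tmp => _ [V VF <-].
  apply/lee_addgt0Pr => e e0.
  have [r /= r0 rV] : exists2 r : R, 0 < r &
      forall y : Z, `|y| < r -> y != 0 -> V y.
    move: VF; rewrite /dnbhs => /nbhs_ballP[r r0 rV]; exists r => // y yr.
    by apply: rV; rewrite -ball_normE /= sub0r normrN.
  have [|y yt hy] := rough n z (r / 2) e n0 z1 _ e0; first lra.
  have y0 : y != 0 by rewrite -normr_gt0 yt; lra.
  rewrite -leeBlDr//; apply: (@le_trans _ _ (average_quotient z y)%:E).
    rewrite -EFinB lee_fin /average_quotient -mulr_suml.
    by rewrite ler_pdivlMl ?ltr0n// ler_pdivlMr ?yt; last lra.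
  by apply: ereal_sup_ubound; exists y => //; apply: rV => //; rewrite yt; lra.
Qed.
End roughness_at_scale.

(** * Transfer of roughness between spaces *)

Section transfer.
Context {R : realType}.

(** Normalising [a] costs at most [h], replacing [|c|] by 1 at most [h * |w|]; the sign of [c] only
    swaps the two summands. *)
Lemma symmetric_sum_perturb (W : normedModType R) (a w : W) (c h : R) :
  a != 0 -> 1 - h <= `|a| <= 1 -> 1 - h <= `|c| <= 1 ->
  `| `|a|^-1 *: a + w| + `| `|a|^-1 *: a - w| - 2 * h * (1 + `|w|)
    <= `|a + c *: w| + `|a - c *: w|.
Proof.
move=> a0 /andP[ha a1] /andP[hc c1].
set b := `|a|^-1 *: a.
have bD v : `|b + v| - h * (1 + `|v|) <= `|a + `|c| *: v|.
  have -> : b + v = (a + `|c| *: v) + ((b - a) + (1 - `|c|) *: v).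
    by rewrite addrACA [a + (b - a)]addrC subrK -scalerDl [_ + (1 - _)]addrC subrK scale1r.
  have hba : `|b - a| <= h.
    rewrite /b -[X in _ - X]scale1r -scalerBl normrZ ger0_norm; last first.
      by rewrite subr_ge0 invf_ge1 ?normr_gt0.
    by rewrite mulrBl mulVf ?normr_eq0// mul1r; lra.
  have := ler_normD (a + `|c| *: v) ((b - a) + (1 - `|c|) *: v).
  have := ler_normD (b - a) ((1 - `|c|) *: v).
  rewrite normrZ (ger0_norm (_ : 0 <= 1 - `|c|)); last lra.
  have : (1 - `|c|) * `|v| <= h * `|v| by rewrite ler_wpM2r//; lra.
  lra.
have := bD w; have := bD (- w); rewrite normrN !scalerN.
have [c0|c0] := leP 0 c; first by rewrite (ger0_norm c0); lra.
by rewrite (ltr0_norm c0) !scaleNr opprK; lra.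
Qed.

(** The common core of (a) and (b): [W] is the dual of [X], respectively [Y], and [J w] is a
    rank-one operator. The data may depend on [h], which is chosen after [t] and [e]. *)
Lemma average_rough_transfer (W Z : normedModType R) (delta : R) :
  average_rough W delta ->
  (forall (n : nat) (z : 'I_n -> Z) (h : R), (0 < n)%N ->
    (forall i, `|z i| = 1) -> 0 < h < 1 ->
    exists (J : W -> Z) (a : 'I_n -> W) (c : 'I_n -> R),
    [/\ forall w, `|J w| = `|w|, forall i, 1 - h <= `|a i|,
        forall i, 1 - h <= `|c i| <= 1 &
        forall i w, `|a i + c i *: w| <= `|z i + J w| /\
                    `|a i - c i *: w| <= `|z i - J w|]) ->
  average_rough Z delta.
Proof.
move=> /average_rough_at_scale roughW emb; apply/average_rough_at_scale.
move=> n z t e n0 z1 t0 e0.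
(* Each summand loses [2 * h * (1 + t) <= e / 2 * t]; roughness of [W] uses up the other [e / 2].
   The bound [2^-1] keeps [a i] nonzero. *)
pose h := Num.min (2^-1) (e * t / (4 * (1 + t))).
have h0 : 0 < h by rewrite lt_min invr_gt0 ltr0n/= divr_gt0 ?mulr_gt0//; lra.
have h1 : h < 1 by rewrite gt_min; apply/orP; left; lra.
have ht : 4 * h * (1 + t) <= e * t.
  rewrite mulrAC -ler_pdivlMl; last by rewrite mulr_gt0//; lra.
  by rewrite [leRHS]mulrC ge_min lexx orbT.
have [//|J [a [c [Jn ha hc hz]]]] := emb n z h n0 z1; first by rewrite h0.
have a0 i : a i != 0 by rewrite -normr_gt0; have := ha i; lra.
have a1 i : `|a i| <= 1.
  (* [J 0 = 0] because [J] preserves norms, so [w = 0] compares [a i] with [z i]. *)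
  have [+ _] := hz i 0; rewrite scaler0 addr0 => /le_trans; apply.
  by rewrite (normr0_eq0 (_ : `|J 0| = 0)) ?Jn ?normr0// addr0 z1.
have [||w wt hw] := roughW n (fun i => `|a i|^-1 *: a i) t (e / 2) n0 _ t0 _.
- by move=> i; rewrite normrZ normfV normr_id mulVf ?normr_eq0.
- lra.
exists (J w); first by rewrite Jn.
apply: (@le_trans _ _ (\sum_(i < n) (`| `|a i|^-1 *: a i + w| +
    `| `|a i|^-1 *: a i - w| - 2 - e / 2 * t))); last first.
  apply: ler_sum => i _.
  have := symmetric_sum_perturb _ (a i) w (c i) h (a0 i); rewrite ha a1 => /(_ isT (hc i)).
  have [] := hz i w; rewrite wt; lra.
rewrite sumrB sumr_const card_ord -mulr_natl; move: hw.
set S := \sum_(_ < _) _; lra.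
Qed.

End transfer.

(** * Adjoints and rank-one operators *)

Section operators.
Context {R : realType} {X Y : normedModType R}.
Implicit Types (f : dual X) (g : dual Y) (T : boundedOp X Y).

Lemma le_norm_op (U V : normedModType R) (T : boundedOp U V) x :
  `|T x| <= `|T| * `|x|.
Proof. exact: le_opnorm. Qed.

Lemma norm_attained_approx (U V : normedModType R) (T : boundedOp U V) m :
  m < `|T| -> exists2 x, `|x| <= 1 & m < `|T x|.
Proof. by move=> /(sup_gt (opnorm_has_sup T).1)[_ [x x1 <-]]; exists x. Qed.

Lemma dual_attained_approx f m :
  m < `|f| -> exists2 x, `|x| <= 1 & m < f x.
Proof.
move=> /norm_attained_approx[x x1]; rewrite real_lter_normr ?num_real// => /orP[|mf].
  by exists x.
by exists (- x); rewrite ?normrN// linearN.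
Qed.

Lemma comp_dual_bounded g T : (g \o T : X -> R^o) \in @bounded_linear R X R^o.
Proof.
apply/asboolP; split=> [a x y|]; first by rewrite /= !linearP.
exists (`|g| * `|T|) => x; rewrite (le_trans (le_norm_op _ _ g _))// -mulrA.
by rewrite ler_wpM2l// le_norm_op.
Qed.

(** The adjoint of [T] applied to [g]. *)
Definition comp_dual g T : dual X := BoundedOp (comp_dual_bounded g T).

Lemma norm_comp_dual g T : `|g| <= 1 -> `|comp_dual g T| <= `|T|.
Proof.
move=> g1; apply: opnorm_le => x x1 /=.
rewrite (le_trans (le_norm_op _ _ g _))// (@le_trans _ _ `|T x|) ?ler_piMl//.
exact: le_opnorm1.
Qed.

Lemma rank1_bounded f (y : Y) : (fun x => f x *: y) \in @bounded_linear R X Y.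
Proof.
apply/asboolP; split=> [a x x'|]; first by rewrite linearP scalerDl -scalerA.
exists (`|f| * `|y|) => x; rewrite normrZ mulrAC ler_wpM2r//; exact: le_norm_op.
Qed.

Definition rank1 f (y : Y) : boundedOp X Y := BoundedOp (rank1_bounded f y).

Lemma norm_rank1 f y : `|rank1 f y| = `|f| * `|y|.
Proof.
apply/eqP; rewrite eq_le; apply/andP; split.
  apply: opnorm_le => x x1 /=; rewrite normrZ ler_wpM2r//; exact: le_opnorm1.
have [->|y0] := eqVneq y 0; first by rewrite normr0 mulr0.
rewrite -ler_pdivlMr ?normr_gt0//; apply: opnorm_le => x x1.
rewrite ler_pdivlMr ?normr_gt0// -normrZ; exact: (le_opnorm1 (rank1 f y)).
Qed.

Lemma finite_rank_rank1 f y : finite_rank (rank1 f y).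
Proof.
have [f0|/existsNP[x /eqP fx]] := pselect (forall x, f x = 0).
  (* For [f = 0] the range is trivial, so the empty family must span it. *)
  exists 0%N, (fun _ => 0); apply/seteqP; split=> [_ [x _ <-]|_ [c _ <-]].
    by exists (fun _ => 0) => //; rewrite big_ord0 /= f0 scale0r.
  by exists 0 => //=; rewrite big_ord0 f0 scale0r.
exists 1%N, (fun _ => y); apply/seteqP; split=> [_ [u _ <-]|_ [c _ <-]].
  by exists (fun _ => f u) => //; rewrite big_ord1.
exists ((c ord0 / f x) *: x) => //=.
by rewrite big_ord1 linearZ/= /GRing.scale/= divfK.
Qed.

End operators.

(** * The two roughness results for operator spaces *)

Section operator_spaces.
Context {R : realType} {X Y : normedModType R}.
Context (H : submodClosed (boundedOp X Y)).
Context (finite_rank_in : forall T : boundedOp X Y, finite_rank T -> T \in H).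

Definition rank1_in (f : dual X) (y : Y) : subspaceOf H :=
  SubspaceOf (finite_rank_in _ (finite_rank_rank1 f y)).

Lemma norm_rank1_in f y : `|rank1_in f y| = `|f| * `|y|.
Proof. exact: norm_rank1. Qed.

(* The octahedral direction [y] and the functional [g] nearly norming both [T x]
   and [y] turn [T] into [g \o T], an almost unit vector of the dual. *)
Lemma average_rough_of_dual (delta : R) :
  average_rough (dual X) delta -> alternatively_octahedral Y ->
  average_rough (subspaceOf H) delta.
Proof.
move=> rough oct; apply: average_rough_transfer rough _ => n T h n0 T1 /andP[h0 h1].
pose S i : boundedOp X Y := subspaceOf_val (T i).
have S1 i : `|S i| = 1 by rewrite -(T1 i).
(* Both [|S i (x i)|] and [g i (u i)] will be at least [1 - k], and [(1 - k) * (1 - k) >= 1 - h]. *)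
have [k k0 hk] : exists2 k, 0 < k & h = 2 * k by exists (h / 2); lra.
have /choice[x hx] i : exists x, `|x| <= 1 /\ 1 - k < `|S i x|.
  have [|x x1 hx] := @norm_attained_approx R X Y (S i) (1 - k); last by exists x.
  by rewrite S1; lra.
have Tx0 i : 0 < `|S i (x i)|.
  by have [_] := hx i; lra.
pose u i := `|S i (x i)|^-1 *: S i (x i).
have u1 i : `|u i| = 1.
  by rewrite normrZ normfV normr_id mulVf ?gt_eqF.
have [y y1 hy] := oct n u k n0 u1 k0.
have /choice[g hg] i : exists g : dual Y,
    [/\ `|g| <= 1, 1 - k <= g (u i) & 1 - k <= `|g y| <= 1].
  have gle (g : dual Y) v : `|g| <= 1 -> `|v| = 1 -> `|g v| <= 1.
    by move=> ? v1; rewrite (le_trans (le_norm_op _ _ g v))// v1 mulr1.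
  (* The functional norms [u i + y] or [u i - y], whichever is long: two numbers of modulus at most
     1 whose sum is at least [2 - k] are each at least [1 - k]. *)
  have := hy i; rewrite le_max => /orP[] hyi.
  - have [g [g1 gz]] := norming_functional _ (u i + y).
    exists g; have := gle g _ g1 (u1 i); have := gle g _ g1 y1.
    move: gz; rewrite linearD /= => gz gy gu.
    have := ler_norm (g y); have := ler_norm (g (u i)); split=> //; first lra.
    by rewrite gy andbT; lra.
  - have [g [g1 gz]] := norming_functional _ (u i - y).
    exists g; have := gle g _ g1 (u1 i); have := gle g _ g1 y1.
    move: gz; rewrite linearB /= => gz gy gu.
    have := ler_norm (- g y); have := ler_norm (g (u i)).
    rewrite normrN; split=> //; first lra.
    by rewrite gy andbT; lra.
exists (fun f => rank1_in f y), (fun i => comp_dual (g i) (S i)), (fun i => g i y).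
split=> [f|i|i|i f].
- by rewrite norm_rank1_in y1 mulr1.
- have [x1 Tx] := hx i; have [g1 gu _] := hg i.
  apply: le_trans (le_opnorm1 (comp_dual (g i) (S i)) x1).
  apply: le_trans (ler_norm _); rewrite /=.
  have -> : S i (x i) = `|S i (x i)| *: u i.
    by rewrite scalerA divff ?scale1r ?gt_eqF.
  rewrite linearZ /= /GRing.scale /=.
  apply: (@le_trans _ _ ((1 - k) * (1 - k))); first by nra.
  by apply: ler_pM => //; lra.
- have [_ _ /andP[? ->]] := hg i; rewrite andbT; lra.
- have [g1 _ _] := hg i.
  (* Composing the perturbed operator with [g i] gives [comp_dual (g i) (S i)] plus or minus
     [g i y *: f]. *)
  split; (apply: le_trans; last exact: norm_comp_dual g1);
    rewrite le_eqVlt; apply/orP; left; apply/eqP; congr (`| _ |);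
    apply/val_inj/funext => v.
  + rewrite /= [in RHS]linearD [in RHS]linearZ/=.
    by rewrite /GRing.scale/= mulrC.
  + rewrite /= [in RHS]linearB [in RHS]linearZ/=.
    by rewrite /GRing.scale/= mulrC.
Qed.

(* Dually, the octahedral functional [f] and the point [x] where both [f] and
   [g \o T] are nearly attained turn [T] into the almost unit vector [T x]. *)
Lemma average_rough_of_range (delta : R) :
  alternatively_octahedral (dual X) -> average_rough Y delta ->
  average_rough (subspaceOf H) delta.
Proof.
move=> oct rough; apply: average_rough_transfer rough _ => n T h n0 T1 /andP[h0 h1].
pose S i : boundedOp X Y := subspaceOf_val (T i).
have S1 i : `|S i| = 1 by rewrite -(T1 i).
(* Here [|a i| > 1 - k], while [u i (x i)] loses one [k] to octahedrality and one to near
   attainment; [(1 - k) * (1 - 2 * k) >= 1 - h]. *)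
have [k k0 hk] : exists2 k, 0 < k & h = 3 * k by exists (h / 3); lra.
have /choice[g hg] i : exists g : dual Y,
    `|g| <= 1 /\ 1 - k < `|comp_dual g (S i)|.
  have [|v v1 hv] := @norm_attained_approx R X Y (S i) (1 - k).
    by rewrite S1; lra.
  have [g [g1 gv]] := norming_functional _ (S i v).
  exists g; split=> //; apply: lt_le_trans (le_opnorm1 _ v1).
  by rewrite /= gv normr_id.
pose a i : dual X := comp_dual (g i) (S i).
have a0 i : 0 < `|a i| by have [_] := hg i; rewrite /a; lra.
pose u i : dual X := `|a i|^-1 *: a i.
have u1 i : `|u i| = 1.
  by rewrite normrZ normfV normr_id mulVf ?gt_eqF.
have [f f1 hf] := oct n u k n0 u1 k0.
have /choice[x hx] i : exists x,
    [/\ `|x| <= 1, 1 - 2 * k <= u i x & 1 - 2 * k <= `|f x| <= 1].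
  have le1 (p : dual X) v : `|p| = 1 -> `|v| <= 1 -> `|p v| <= 1.
    by move=> p1 v1; rewrite (le_trans (le_opnorm1 p v1))// -p1.
  have := hf i; rewrite le_max => /orP[] hfi.
  - have [|x x1 hx] := @dual_attained_approx _ _ (u i + f) (2 - 2 * k); first lra.
    exists x; have fx := le1 _ _ f1 x1; have ux := le1 _ _ (u1 i) x1.
    rewrite fx andbT; have := ler_norm (f x); have := ler_norm (u i x).
    have {}hx : 2 - 2 * k < u i x + f x by exact: hx.
    by split=> //; lra.
  - have [|x x1 hx] := @dual_attained_approx _ _ (u i - f) (2 - 2 * k); first lra.
    exists x; have fx := le1 _ _ f1 x1; have ux := le1 _ _ (u1 i) x1.
    rewrite fx andbT; have := ler_norm (- f x); have := ler_norm (u i x).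
    have {}hx : 2 - 2 * k < u i x - f x by exact: hx.
    by rewrite normrN; split=> //; lra.
exists (fun w => rank1_in f w), (fun i => S i (x i)), (fun i => f (x i)).
split=> [w|i|i|i w].
- by rewrite norm_rank1_in f1 mul1r.
- have [g1 ga] := hg i; have [x1 ux _] := hx i.
  have : a i (x i) <= `|S i (x i)|.
    rewrite /a /= (le_trans (ler_norm _))// (le_trans (le_norm_op _ _ (g i) _))//.
    by rewrite ler_piMl.
  apply: le_trans.
  have -> : a i (x i) = `|a i| * u i (x i).
    by rewrite /u /= [X in _ * X]/GRing.scale /= mulVKf ?gt_eqF.
  apply: (@le_trans _ _ ((1 - k) * (1 - 2 * k))); first by nra.
  by apply: ler_pM => //; [lra|lra|exact: ltW].
- have [_ _ /andP[? ->]] := hx i; rewrite andbT; lra.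
- have [x1 _ _] := hx i.
  (* Evaluation of the perturbed operators at [x i], a point of the unit ball. *)
  by split; [exact: (le_opnorm1 (S i + rank1 f w))|
             exact: (le_opnorm1 (S i - rank1 f w))].
Qed.

End operator_spaces.

Theorem theorem2p1 (R : realType) (X Y : completeNormedModType R)
    (H : submodClosed (boundedOp X Y)) (delta : R) :
  (exists x : X, x != 0) -> (exists y : Y, y != 0) ->
  closed [set T : boundedOp X Y | T \in H] ->
  (forall T : boundedOp X Y, finite_rank T -> T \in H) ->
  0 < delta ->
  (average_rough (dual X) delta -> alternatively_octahedral Y ->
     average_rough (subspaceOf H) delta) /\
  (alternatively_octahedral (dual X) -> average_rough Y delta ->
     average_rough (subspaceOf H) delta).
Proof.
move=> _ _ _ finite_rank_in _; split.
- exact: average_rough_of_dual.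
- exact: average_rough_of_range.
Qed.
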